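(* Let $Q=Q^{T}\in\mathbb{R}^{n\times n}$ be a symmetric indefinite matrix and let $\boldsymbol{c}\in\mathbb{R}^{n}$ be a nonzero vector. If $\overline{\boldsymbol{\lambda}}\in\mathcal{S}^{+}$ is a critical point of the Lagrangian dual function $g$ (that is, $\nabla g(\overline{\boldsymbol{\lambda}})=0$), then $\overline{\boldsymbol{x}}=Q^{-1}(\overline{\boldsymbol{\lambda}})\,\boldsymbol{c}$ is a global solution to the boolean quadratic programming (BQP) problem $\min\{f(\boldsymbol{x}) \mid \boldsymbol{x}\in\{-1,1\}^{n}\}$; that is, $\overline{\boldsymbol{x}}\in\{-1,1\}^{n}$ and $f(\overline{\boldsymbol{x}})\le f(\boldsymbol{x})$ for all $\boldsymbol{x}\in\{-1,1\}^{n}$.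
   Context: The objective function is $f(\boldsymbol{x})=\frac{1}{2}\boldsymbol{x}^{T}Q\boldsymbol{x}-\boldsymbol{c}^{T}\boldsymbol{x}$ for $\boldsymbol{x}\in\mathbb{R}^n$. For $\boldsymbol{\lambda}=(\lambda_1,\dots,\lambda_n)^T\in\mathbb{R}^n$, let $Q(\boldsymbol{\lambda})=Q+\operatorname{diag}(\boldsymbol{\lambda})$, where $\operatorname{diag}(\boldsymbol{\lambda})$ is the diagonal matrix with diagonal entries $\lambda_1,\dots,\lambda_n$, and write $Q^{-1}(\boldsymbol{\lambda})$ for the inverse of the matrix $Q(\boldsymbol{\lambda})$. The dual feasible space is $\mathcal{S}^{+}=\{\boldsymbol{\lambda}\in\mathbb{R}^{n}\mid Q(\boldsymbol{\lambda})\succ 0\}$, where $\succ 0$ means positive definite. Let $\boldsymbol{e}\in\mathbb{R}^n$ be the vector with all entries equal to one. The Lagrangian dual function $g:\mathcal{S}^{+}\to\mathbb{R}$ is $g(\boldsymbol{\lambda})=-\frac{1}{2}\boldsymbol{c}^{T}Q^{-1}(\boldsymbol{\lambda})\boldsymbol{c}-\frac{1}{2}\boldsymbol{\lambda}^{T}\boldsymbol{e}$. *)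

(* Defs.v *)
From HB Require Import structures.
From mathcomp Require Import all_boot all_order all_algebra.
From mathcomp Require Import all_classical all_reals all_analysis.

Set Implicit Arguments.
Unset Strict Implicit.
Unset Printing Implicit Defensive.
Import Order.TTheory GRing.Theory Num.Theory.
Import numFieldNormedType.Exports.

Local Open Scope classical_set_scope.
Local Open Scope ring_scope.

Definition dotv (R : realType) (n : nat) (u v : 'cV[R]_n) : R :=
  (u^T *m v) 0 0.

Definition quadform (R : realType) (n : nat) (A : 'M[R]_n) (x : 'cV[R]_n) : R :=
  (x^T *m A *m x) 0 0.

Definition symmetric_mx (R : realType) (n : nat) (A : 'M[R]_n) : Prop :=
  A^T = A.

Definition posdef_mx (R : realType) (n : nat) (A : 'M[R]_n) : Prop :=
  symmetric_mx A /\ forall x : 'cV[R]_n, x != 0 -> 0 < quadform A x.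

Definition indefinite_mx (R : realType) (n : nat) (A : 'M[R]_n) : Prop :=
  (exists x : 'cV[R]_n, 0 < quadform A x) /\
  (exists y : 'cV[R]_n, quadform A y < 0).

(* Every entry is differentiated with the library's total operator 'D_v, so
   [gradient h a] is meaningful only if the partial derivatives exist at [a].
   They do for [dual_fun Q c] at every point [l] of the open set [dual_space Q]:
   it is a rational function of [l] whose denominator does not vanish there. *)
Definition gradient (R : realType) (n : nat) (h : 'cV[R]_n -> R)
    (a : 'cV[R]_n) : 'cV[R]_n :=
  \col_(i < n) 'D_(delta_mx i 0 : 'cV[R]_n) h a.

Definition bqp_obj (R : realType) (n : nat) (Q : 'M[R]_n) (c x : 'cV[R]_n) : R :=
  2^-1 * quadform Q x - dotv c x.

Definition bqp_feasible (R : realType) (n : nat) : set 'cV[R]_n :=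
  [set x | forall i : 'I_n, x i 0 = -1 \/ x i 0 = 1].

Definition shifted_mx (R : realType) (n : nat) (Q : 'M[R]_n) (l : 'cV[R]_n)
    : 'M[R]_n :=
  Q + diag_mx l^T.

Definition dual_space (R : realType) (n : nat) (Q : 'M[R]_n) : set 'cV[R]_n :=
  [set l | posdef_mx (shifted_mx Q l)].

(* Total in [l]; outside [dual_space Q] its values are irrelevant ([invmx] of a
   singular matrix is that matrix itself). *)
Definition dual_fun (R : realType) (n : nat) (Q : 'M[R]_n) (c l : 'cV[R]_n) : R :=
  - (2^-1 * quadform (invmx (shifted_mx Q l)) c) - 2^-1 * dotv l (const_mx 1).

(* Main.v *)
(* Along a coordinate direction [shifted_mx Q l] undergoes a rank one update, so
   the Sherman-Morrison formula gives the partial derivatives of the dual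
   function in closed form: [(xbar_i ^ 2 - 1) / 2].  At a critical point [xbar]
   is therefore a sign vector.  On sign vectors the objective differs by the
   constant [sum_i l_i / 2] from the strictly convex quadratic
   [quadform (shifted_mx Q l) x / 2 - dotv c x], whose minimiser is [xbar]. *)
Require Import Defs.
From HB Require Import structures.
From mathcomp Require Import all_boot all_order all_algebra.
From mathcomp Require Import all_classical all_reals all_analysis.
From mathcomp Require Import ring lra.
Import Order.TTheory GRing.Theory Num.Theory.
Import numFieldNormedType.Exports.
Local Open Scope classical_set_scope.
Local Open Scope ring_scope.

(** The product [v^T *m invmx A *m u] is a scalar, so multiplying the correction term by
    [A + u *m v^T] only rescales [u *m (v^T *m invmx A)] by [d]. The right-hand side is thus a right
    inverse, which for square matrices is the inverse. *)
Lemma sherman_morrison (F : fieldType) (n : nat) (A : 'M[F]_n) (u v : 'cV[F]_n)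
    (d := 1 + (v^T *m invmx A *m u) 0 0) :
  A \in unitmx -> d != 0 ->
  invmx (A + u *m v^T) =
  invmx A - d^-1 *: (invmx A *m u *m (v^T *m invmx A)).
Proof.
move=> Au d0; set B := RHS.
have uvB : (A + u *m v^T) *m (invmx A *m u *m (v^T *m invmx A)) =
    d *: (u *m (v^T *m invmx A)).
  rewrite mulmxDl !mulmxA mulmxV // mul1mx -(mulmxA u v^T (invmx A)).
  rewrite -(mulmxA u (v^T *m invmx A) u) [v^T *m invmx A *m u]mx11_scalar.
  by rewrite mul_mx_scalar -!scalemxAl /d scalerDl scale1r !mulmxA.
have AB : (A + u *m v^T) *m B = 1%:M.
  rewrite mulmxBr -scalemxAr uvB scalerA mulVf // scale1r mulmxDl mulmxV //.
  by rewrite -mulmxA addrK.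
have /mulmx1_unit[Mu _] := AB.
by rewrite -[LHS]mulmx1 -AB mulKmx.
Qed.

(** A nonzero row of the left kernel, once transposed, would be a nonzero vector on which the
    quadratic form vanishes. *)
Lemma posdef_unitmx {R : realType} {n : nat} {A : 'M[R]_n} :
  posdef_mx A -> A \in unitmx.
Proof.
move=> [_ Apos]; rewrite -row_free_unit -kermx_eq0.
apply/eqP/row_matrixP => j; rewrite row0.
have kj0 : row j (kermx A) *m A = 0.
  by apply/sub_kermxP; exact: row_sub.
apply/eqP/negPn/negP => rj0.
have := Apos (row j (kermx A))^T; rewrite trmx_eq0 => /(_ rj0).
by rewrite /quadform trmxK kj0 mul0mx mxE ltxx.
Qed.

(** The sum [h *: u + l] has the order found in the difference quotient that defines the
    derivative. *)
Lemma shifted_mx_update (R : realType) (n : nat) (Q : 'M[R]_n) (l : 'cV[R]_n)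
    (i : 'I_n) (h : R) (u := delta_mx i 0 : 'cV[R]_n) :
  shifted_mx Q (h *: u + l) = shifted_mx Q l + (h *: u) *m u^T.
Proof.
rewrite /shifted_mx -addrA; congr (_ + _); rewrite addrC linearD /= linearD /=.
congr (_ + _); rewrite linearZ /= linearZ /= -scalemxAl trmx_delta mul_delta_mx.
congr (_ *: _); apply/matrixP => j k; rewrite !mxE eqxx /=.
by case: (j =P k) => [<-|/eqP jk]; case: (j =P i) => // ji;
   rewrite ?mulr0n // -ji eq_sym (negbTE jk).
Qed.

(** With [b] the [i]-th diagonal entry of [invmx A], the difference quotient is exactly [2^-1 *
    (xbar i 0 ^+ 2 * (1 + h * b)^-1 - 1)] for small nonzero [h]. The derivative is read off by
    letting [h] tend to 0. *)
Lemma derive_dual_fun (R : realType) (n : nat) (Q : 'M[R]_n) (c l : 'cV[R]_n)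
    (i : 'I_n) (xbar := invmx (shifted_mx Q l) *m c) :
  dual_space Q l ->
  'D_(delta_mx i 0 : 'cV[R]_n) (dual_fun Q c) l = 2^-1 * (xbar i 0 ^+ 2 - 1).
Proof.
move=> l_dual; have Au := posdef_unitmx l_dual; have [Asym _] := l_dual.
set u := delta_mx i 0 : 'cV[R]_n; set A := shifted_mx Q l in xbar Au Asym *.
pose b := (u^T *m invmx A *m u) 0 0.
have ux : u^T *m xbar = (xbar i 0)%:M.
  by rewrite [LHS]mx11_scalar trmx_delta -rowE mxE.
(* By symmetry of [A], this is the transpose of [ux]. *)
have xu : c^T *m invmx A *m u = (xbar i 0)%:M.
  apply: trmx_inj; rewrite !trmx_mul trmxK trmx_inv Asym ux.
  by rewrite tr_scalar_mx.
have d_cvg : (1 + h * b) @[h --> (0 : R)^'] --> (1 : R).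
  rewrite -[X in _ --> X](addr0 1) -[X in 1 + X](mul0r b).
  apply: cvgD; first exact: cvg_cst.
  by apply: cvgM; [exact: cvg_within | exact: cvg_cst].
have d_neq0 : \forall h \near (0 : R)^', 1 + h * b != 0.
  by have := cvgr_neq0 _ d_cvg; apply; exact: oner_neq0.
apply: cvg_lim => //.
(* The factor [1^-1] displays the limit of [(1 + h * b)^-1]. *)
have -> : 2^-1 * (xbar i 0 ^+ 2 - 1) = 2^-1 * (xbar i 0 ^+ 2 * 1^-1 - 1).
  by rewrite invr1 mulr1.
apply: (@cvg_trans _
  ((2^-1 * (xbar i 0 ^+ 2 * (1 + h * b)^-1 - 1)) @[h --> 0^'])); last first.
  apply: cvgM; first exact: cvg_cst.
  apply: cvgB; last exact: cvg_cst.
  apply: cvgM; first exact: cvg_cst.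
  by apply: cvgV; [exact: oner_neq0 | exact: d_cvg].
(* The two expressions need only agree where [h] and [1 + h * b] are both nonzero, that is, on a
   punctured neighbourhood of 0. *)
apply: near_eq_cvg; near=> h.
have h0 : h != 0 by near: h; exact: nbhs_dnbhs_neq.
have d0 : 1 + h * b != 0 by near: h.
have dE : 1 + (u^T *m invmx A *m (h *: u)) 0 0 = 1 + h * b.
  by rewrite -scalemxAr mxE.
have quadE : quadform (invmx (shifted_mx Q (h *: u + l))) c =
    quadform (invmx A) c - (1 + h * b)^-1 * h * xbar i 0 ^+ 2.
  rewrite shifted_mx_update -/u -/A sherman_morrison ?dE // /quadform.
  rewrite mulmxBr mulmxBl mxE; congr (_ + _); rewrite mxE; congr (- _).
  rewrite -!(scalemxAl, scalemxAr) scalerA mxE; congr (_ * _).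
  rewrite !mulmxA xu -!mulmxA ux -scalar_mxM mxE eqxx mulr1n.
  by rewrite expr2.
have linE : dotv (h *: u + l) (const_mx 1) = h + dotv l (const_mx 1).
  rewrite /dotv linearD linearZ /= mulmxDl mxE; congr (_ + _).
  by rewrite -scalemxAl trmx_delta -rowE !mxE mulr1.
rewrite /dual_fun /= -/A quadE linE /GRing.scale /=.
by field; rewrite d0 h0.
Unshelve. all: by end_near.
Qed.

Lemma quadform_diag_sign (R : realType) (n : nat) (l x : 'cV[R]_n) :
  bqp_feasible x -> quadform (diag_mx l^T) x = \sum_i l i 0.
Proof.
move=> xS; rewrite /quadform -mulmxA mxE; apply: eq_bigr => i _.
rewrite mul_diag_mx !mxE mulrCA -expr2.
by case: (xS i) => ->; rewrite ?sqrrN expr1n mulr1.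
Qed.

Lemma bqp_obj_shifted (R : realType) (n : nat) (Q : 'M[R]_n) (c l x : 'cV[R]_n) :
  bqp_feasible x ->
  bqp_obj Q c x = bqp_obj (shifted_mx Q l) c x - 2^-1 * \sum_i l i 0.
Proof.
move=> xS; rewrite -(quadform_diag_sign _ _ l _ xS) /bqp_obj /shifted_mx.
have -> : quadform (Q + diag_mx l^T) x = quadform Q x + quadform (diag_mx l^T) x.
  by rewrite /quadform mulmxDr mulmxDl mxE.
by ring.
Qed.

(** Completing the square: with [y = invmx A *m c], the objective at [x] exceeds its value at [y] by
    half of [quadform A (x - y)]. *)
Lemma bqp_obj_posdef_min (R : realType) (n : nat) (A : 'M[R]_n)
    (c x : 'cV[R]_n) :
  posdef_mx A -> bqp_obj A c (invmx A *m c) <= bqp_obj A c x.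
Proof.
move=> Apd; have Au := posdef_unitmx Apd; have [Asym Apos] := Apd.
set y := invmx A *m c.
have Ay : A *m y = c by rewrite mulKVmx.
have yA : y^T *m A = c^T by rewrite -Ay [RHS]trmx_mul Asym.
(* A 1 by 1 matrix equals its own transpose. *)
have xc : x^T *m c = c^T *m x.
  by rewrite [LHS]mx11_scalar -tr_scalar_mx -mx11_scalar trmx_mul trmxK.
have sq : quadform A (x - y) = quadform A x - 2 * dotv c x + dotv c y.
  rewrite /quadform /dotv [(x - y)^T]linearB /=.
  rewrite !(mulmxBl, mulmxBr) yA -!mulmxA Ay xc.
  by rewrite !mxE; ring.
have : 0 <= quadform A (x - y).
  have [->|/Apos/ltW//] := eqVneq (x - y) 0.
  by rewrite /quadform mulmx0 mxE.
have -> : bqp_obj A c y = - (2^-1 * dotv c y).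
  by rewrite /bqp_obj /quadform yA /dotv; lra.
by rewrite sq /bqp_obj; lra.
Qed.

Theorem theorem1 (R : realType) (n : nat) (Q : 'M[R]_n) (c : 'cV[R]_n)
    (Qsym : symmetric_mx Q) (Qindef : indefinite_mx Q) (c_neq0 : c != 0)
    (l : 'cV[R]_n) (l_dual : dual_space Q l)
    (l_crit : gradient (dual_fun Q c) l = 0) :
  let xbar := invmx (shifted_mx Q l) *m c in
  bqp_feasible xbar /\
  forall x : 'cV[R]_n, bqp_feasible x -> bqp_obj Q c xbar <= bqp_obj Q c x.
Proof.
move=> xbar.
have xbarS : bqp_feasible xbar.
  move=> i; have /eqP : 2^-1 * (xbar i 0 ^+ 2 - 1) = 0.
    have := congr1 (fun g : 'cV[R]_n => g i 0) l_crit.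
    by rewrite mxE derive_dual_fun // => ->; rewrite mxE.
  rewrite mulf_eq0 invr_eq0 pnatr_eq0 /= subr_eq0 sqrf_eq1.
  by case/orP => /eqP; [right | left].
(* Since [xbar] and [x] are both sign vectors, the two shifts subtract the same constant, which
   cancels. *)
split=> // x xS; rewrite (bqp_obj_shifted _ _ _ _ l _ xbarS).
rewrite (bqp_obj_shifted _ _ _ _ l _ xS).
by rewrite lerD2r; exact: bqp_obj_posdef_min.
Qed.
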